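(* Let $f:\mathbb{R}^d\to\mathbb{R}$ be differentiable with a global minimizer $w_*$, and assume that $f$ is $L$-smooth ($L>0$) and $(\rho,\mu)$-strongly quasar convex with respect to $w_*$, where $\rho>0$ and $\mu>0$. (i) Let $\gamma_t=\frac1L$, $\gamma'_t=\frac1{\sqrt{\mu L}}$, $\eta'_t=\rho\sqrt{\frac\mu L}$, $\eta_t=\sqrt{\frac\mu L}$. Then the component $w_t$ of the continuized process $(w_t,z_t)$ with these parameters satisfies, for all $t\ge0$, $$\mathbb{E}[f(w_t)-f(w_* )]\le\left(f(w_0)-f(w_* )+\frac\mu2\|z_0-w_*\|^2\right)\exp\left(-\rho\sqrt{\frac\mu L}\,t\right).$$ (ii) For the discrete-time algorithm with parameters $$\tau_k=\frac1{1+\rho}\left(1-\exp\left(-(1+\rho)\sqrt{\tfrac\mu L}(T_{k+1}-T_k)\right)\right),\qquad \tau'_k=\frac{\rho\left(1-\exp\left(-(1+\rho)\sqrt{\tfrac\mu L}(T_{k+1}-T_k)\right)\right)}{\rho+\exp\left(-(1+\rho)\sqrt{\tfrac\mu L}(T_{k+1}-T_k)\right)},$$ $\tilde\gamma_k=\frac1L$ and $\tilde\gamma'_k=\frac1{\sqrt{\mu L}}$, the iterate $\tilde w_k$ satisfies, for all $k\ge0$, $$\mathbb{E}\left[\exp\left(\rho\sqrt{\frac\mu L}\,T_k\right)\left(f(\tilde w_k)-f(w_* )\right)\right]\le f(\tilde w_0)-f(w_* )+\frac\mu2\|\tilde z_0-w_*\|^2.$$ The expectation is over the Poisson process (the random times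 $T_1,T_2,\dots$).
   Context: Norms and inner products on $\mathbb{R}^d$ are Euclidean. $f$ is $L$-smooth if $f(x)\le f(y)+\langle\nabla f(y),x-y\rangle+\frac L2\|x-y\|^2$ for all $x,y\in\mathbb{R}^d$. $f$ is $(\rho,\mu)$-strongly quasar convex with respect to the global minimizer $w_*$ if $f(w_* )\ge f(w)+\frac1\rho\langle\nabla f(w),w_*-w\rangle+\frac\mu2\|w_*-w\|^2$ for all $w\in\mathbb{R}^d$. Random times: $T_0=0<T_1<T_2<\cdots$, where the increments $T_1,T_2-T_1,T_3-T_2,\dots$ are i.i.d. exponential random variables with mean $1$; $dN(t)=\sum_{k\ge1}\delta_{T_k}(dt)$ is the associated Poisson point measure. Continuized process: given parameter functions $\eta_t,\eta'_t,\gamma_t,\gamma'_t$ and deterministic initial points $w_0,z_0\in\mathbb{R}^d$, $$dw_t=\eta_t(z_t-w_t)\,dt-\gamma_t\nabla f(w_t)\,dN(t),\qquad dz_t=\eta'_t(w_t-z_t)\,dt-\gamma'_t\nabla f(w_t)\,dN(t).$$ That is, between consecutive random times $(w_t,z_t)$ solves the ODEs $\dot w_t=\eta_t(z_t-w_t)$, $\dot z_t=\eta'_t(w_t-z_t)$, and at time $T_k$ it jumps: $w_{T_k}=w_{T_k-}-\gamma_{T_k}\nabla f(w_{T_k-})$, $z_{T_k}=z_{T_k-}-\gamma'_{T_k}\nabla f(w_{T_k-})$, where $T_k-$ denotes the left limit. Discrete-time algorithm: given (possibly random) parameters and deterministic initial points $\tilde w_0,\tilde z_0\in\mathbb{R}^d$,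 for $k=0,1,2,\dots$: $$\tilde v_k=\tilde w_k+\tau_k(\tilde z_k-\tilde w_k),\quad \tilde w_{k+1}=\tilde v_k-\tilde\gamma_{k+1}\nabla f(\tilde v_k),\quad \tilde z_{k+1}=\tilde z_k+\tau'_k(\tilde v_k-\tilde z_k)-\tilde\gamma'_{k+1}\nabla f(\tilde v_k).$$ *)

(* Defs.v *)
From HB Require Import structures.
From mathcomp Require Import all_boot all_order all_algebra.
From mathcomp Require Import finmap.
From mathcomp Require Import all_classical all_reals all_analysis.

Set Implicit Arguments.
Unset Strict Implicit.
Unset Printing Implicit Defensive.

Import Order.TTheory GRing.Theory Num.Theory.
Import numFieldNormedType.Exports.

Local Open Scope classical_set_scope.
Local Open Scope ring_scope.

Section Euclidean.
Context {R : realType} {d : nat}.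
Implicit Types (f : 'rV[R]_d -> R) (x y : 'rV[R]_d).

Definition dotp x y : R := \sum_(i < d) x 0 i * y 0 i.

(* The library norm [`|x|] on ['rV[R]_d] is the sup norm; it induces the same
   topology and derivatives as the Euclidean norm below. *)
Definition enorm x : R := Num.sqrt (dotp x x).

Definition grad f x : 'rV[R]_d := \row_(i < d) 'D_(delta_mx 0 i) f x.

Definition global_minimizer f wstar := forall w, f wstar <= f w.

Definition smooth L f := forall x y,
  f x <= f y + dotp (grad f y) (x - y) + L / 2 * enorm (x - y) ^+ 2.

Definition strongly_quasar_convex rho mu f wstar := forall w,
  f wstar >= f w + rho^-1 * dotp (grad f w) (wstar - w)
             + mu / 2 * enorm (wstar - w) ^+ 2.

End Euclidean.

Section RandomTimes.
Context {R : realType} {disp : measure_display} {Omega : measurableType disp}.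

Definition mutually_independent (P : probability Omega R)
    (X : nat -> Omega -> R) :=
  forall (J : {fset nat}) (A : nat -> set R), (forall i, measurable (A i)) ->
    P (\bigcap_(i in [set` J]) (X i @^-1` A i))
    = (\prod_(i <- J) P (X i @^-1` A i))%E.

Definition increment (T : nat -> Omega -> R) (k : nat) : Omega -> R :=
  T k.+1 \- T k.

Record random_times (P : probability Omega R) (T : nat -> {RV P >-> R})
    : Prop := {
  random_times_order : {ae P, forall omega,
    T 0%N omega = 0 /\ forall k, T k omega < T k.+1 omega};
  random_times_exponential : forall k (A : set R), measurable A ->
    pushforward P (increment T k) A = exponential_prob 1 A;
  random_times_independent :
    mutually_independent P (increment T) }.

End RandomTimes.

Section Algorithms.
Context {R : realType} {d : nat}.
Local Notation V := 'rV[R]_d.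

(* One sample path, driven by the jump times [T 1 < T 2 < ...], with [T 0 = 0].
   Paths are right-continuous, and [wl], [zl] are the left limits at a jump. *)
Record continuized_path (f : V -> R) (eta eta' gamma gamma' : R -> R)
    (w0 z0 : V) (T : nat -> R) (w z : R -> V) : Prop := {
  path_init : w 0 = w0 /\ z 0 = z0;
  path_flow : forall k t, T k < t < T k.+1 ->
    is_derive t 1 w (eta t *: (z t - w t)) /\
    is_derive t 1 z (eta' t *: (w t - z t));
  path_right_continuous : forall k,
    w s @[s --> (T k)^'+] --> w (T k) /\
    z s @[s --> (T k)^'+] --> z (T k);
  path_jump : forall k, exists wl zl : V,
    [/\ w s @[s --> (T k.+1)^'-] --> wl,
        z s @[s --> (T k.+1)^'-] --> zl,
        w (T k.+1) = wl - gamma (T k.+1) *: grad f wl &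
        z (T k.+1) = zl - gamma' (T k.+1) *: grad f wl] }.

(* Measurability in ['rV[R]_d] is stated coordinatewise. *)
Record continuized_process (disp : measure_display)
    (Omega : measurableType disp) (P : probability Omega R)
    (T : nat -> {RV P >-> R}) (f : V -> R) (eta eta' gamma gamma' : R -> R)
    (w0 z0 : V) (w z : R -> Omega -> V) : Prop := {
  process_measurable : forall t i, 0 <= t ->
    measurable_fun setT (fun omega => w t omega 0 i) /\
    measurable_fun setT (fun omega => z t omega 0 i);
  process_path : {ae P, forall omega,
    continuized_path f eta eta' gamma gamma' w0 z0
      (fun k => T k omega) (w^~ omega) (z^~ omega)} }.

(* The pair [(w_k, z_k)]. *)
Fixpoint discrete_iter (f : V -> R) (tau tau' gamma gamma' : nat -> R)
    (w0 z0 : V) (k : nat) : V * V :=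
  if k is k'.+1 then
    let: (w, z) := discrete_iter f tau tau' gamma gamma' w0 z0 k' in
    let v := w + tau k' *: (z - w) in
    (v - gamma k'.+1 *: grad f v,
     z + tau' k' *: (v - z) - gamma' k'.+1 *: grad f v)
  else (w0, z0).

End Algorithms.

(* Main.v *)
Require Import Defs.
From HB Require Import structures.
From mathcomp Require Import all_boot all_order all_algebra.
From mathcomp Require Import finmap.
From mathcomp Require Import all_classical all_reals all_analysis measurable_realfun.
From mathcomp Require Import ring lra.

Set Implicit Arguments.
Unset Strict Implicit.
Unset Printing Implicit Defensive.

Import Order.TTheory GRing.Theory Num.Theory.
Import numFieldNormedType.Exports.

Local Open Scope classical_set_scope.
Local Open Scope ring_scope.

(** Put [s = sqrt (mu / L)] and [a = rho * s].  Everything rests on the Lyapunov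
    function [V (w, z) = f w - f wstar + mu / 2 * |z - wstar| ^ 2].

    Along the flow the derivative of [V] contains the gradient of [f] only
    through [s <grad f w, z - w>].  A gradient jump changes [V] by at most
    [- s <grad f w, z - wstar>]; this is the descent lemma, and the two step
    sizes are the ones that cancel the squared norm of the gradient
    ([lyapunov_jump]).  The point [z] disappears from the sum of the two
    gradient terms, quasar convexity applies to the remaining [s <grad f w, wstar - w>], and
    one finds [V' + (V o jump - V) <= - a V] ([dissipation]).

    Jumps occur at unit rate, so this inequality is best read between two
    consecutive jumps.  Multiplied by [exp ((a - 1) u)] and integrated over
    [0 <= u <= r], it says that [V] just after a jump is at least the mean of
    [exp (a u) V] just after the next jump, where [u] is the waiting time and
    only [u <= r] counts, plus the value of [exp (a r) V] after time [r] on the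
    flow, weighted with the probability [exp (- r)] that no jump has occurred
    ([flow_energy_integral]).

    Both claims follow by summation, without stochastic calculus.  Let [S k] be
    the time of the k-th jump and [x k] the state just after it.  The state
    [x k] depends only on the first [k] waiting times, which are independent of
    the next one, so the previous inequality can be integrated over the past
    ([expected_energy_step]).  The sum over [k < n] telescopes and bounds the
    mean of [exp (a t) V] at time [t] on the event that fewer than [n] jumps
    have occurred, plus the mean of [exp (a * S n) V (x n)] on the event
    [S n <= t], by the initial energy ([expected_energy_le]).  Letting [n] tend
    to infinity gives the bound for the continuized process, since almost surely
    only finitely many jumps occur before [t] ([ae_interval]); letting [t] tend
    to infinity gives the bound for the discrete algorithm.

    The flow is an explicitly solvable linear system in which [w] moves along
    the segment from [w] to [z].  Its solution turns the sampled process into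
    the discrete algorithm ([discrete_iter_chain], [path_is_chain]). *)

(** * Euclidean inner product and directional derivatives *)

Section Dotp.
Context {R : realType} {d : nat}.
Implicit Types x y z : 'rV[R]_d.

Lemma dotpC x y : dotp x y = dotp y x.
Proof. by apply: eq_bigr => i _; rewrite mulrC. Qed.

Lemma dotpDl x y z : dotp (x + y) z = dotp x z + dotp y z.
Proof. by rewrite -big_split; apply: eq_bigr => i _; rewrite mxE mulrDl. Qed.

Lemma dotpZl a x y : dotp (a *: x) y = a * dotp x y.
Proof. by rewrite /dotp mulr_sumr; apply: eq_bigr => i _; rewrite mxE mulrA. Qed.

Lemma dotpNl x y : dotp (- x) y = - dotp x y.
Proof. by rewrite -scaleN1r dotpZl mulN1r. Qed.

Lemma dotpDr x y z : dotp z (x + y) = dotp z x + dotp z y.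
Proof. by rewrite !(dotpC z) dotpDl. Qed.

Lemma dotpZr a x y : dotp y (a *: x) = a * dotp y x.
Proof. by rewrite !(dotpC y) dotpZl. Qed.

Lemma dotpNr x y : dotp y (- x) = - dotp y x.
Proof. by rewrite !(dotpC y) dotpNl. Qed.

Definition dotpE := (dotpDl, dotpDr, dotpNl, dotpNr, dotpZl, dotpZr).

Lemma dotp_ge0 x : 0 <= dotp x x.
Proof. by apply: sumr_ge0 => i _; rewrite -expr2 sqr_ge0. Qed.

Lemma enorm_sqr x : enorm x ^+ 2 = dotp x x.
Proof. by rewrite sqr_sqrtr // dotp_ge0. Qed.

Lemma derive_dotp (f : 'rV[R]_d -> R) x v :
  differentiable f x -> 'D_v f x = dotp (grad f x) v.
Proof.
move=> df; rewrite deriveE // {1}[v]row_sum_delta linear_sum.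
by apply: eq_bigr => i _; rewrite linearZ mxE deriveE //= mulrC.
Qed.

End Dotp.

(** * Continuity of the gradient of a smooth function *)

Section SmoothGradient.
Context {R : realType} {d : nat} (f : 'rV[R]_d -> R) (L : R).
Hypothesis df : forall x, differentiable f x.
Hypothesis Lf : smooth L f.

(** Upper smoothness bounds the gradient from below by a difference quotient,
    which depends continuously on the base point. *)
Lemma smooth_difference_quotient (x v : 'rV[R]_d) (h : R) : 0 < h ->
  h^-1 * (f (h *: v + x) - f x) - L / 2 * h * dotp v v <= dotp (grad f x) v.
Proof.
move=> h0; rewrite lerBlDr mulrC ler_pdivrMr //.
have := Lf (h *: v + x) x; rewrite addrK enorm_sqr !dotpE.
by nra.
Qed.

(** Fix a step [h] for which the quotient at [y] is close to the derivative at
    [y], then let [x] tend to [y]. *)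
Lemma grad_lower_semicontinuous (y v : 'rV[R]_d) (e : R) : 0 < e ->
  \forall x \near y, dotp (grad f y) v - e < dotp (grad f x) v.
Proof.
move=> e0.
have fcont : continuous f by move=> x; exact: differentiable_continuous.
have quot : h^-1 * (f (h *: v + y) - f y) - L / 2 * h * dotp v v @[h --> 0^'+]
    --> dotp (grad f y) v - L / 2 * 0 * dotp v v.
  apply: cvgB.
    apply: cvg_dnbhs_at_right; rewrite -derive_dotp //.
    exact: diff_derivable.
  apply: cvgMr_tmp; apply: cvgMl_tmp; apply: cvg_at_right_filter; exact: cvg_id.
have [h h0 hlt] : exists2 h : R, 0 < h &
    dotp (grad f y) v - e < h^-1 * (f (h *: v + y) - f y) - L / 2 * h * dotp v v.
  near (0 : R)^'+ => h; exists h; first by near: h; exact: nbhs_right_gt.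
  near: h; apply: (cvgr_gt _ quot).
  by rewrite mulr0 mul0r subr0 gtrBl.
have qc : h^-1 * (f (h *: v + x) - f x) - L / 2 * h * dotp v v @[x --> y] -->
    h^-1 * (f (h *: v + y) - f y) - L / 2 * h * dotp v v.
  apply: (cvgB (F := nbhs y)); last exact: cvg_cst.
  apply: (cvgMl_tmp (F := nbhs y)); apply: (cvgB (F := nbhs y)); last exact: fcont.
  apply: (continuous_comp (f := fun x => h *: v + x) (g := f)); last exact: fcont.
  by apply: (cvgD (F := nbhs y)); [exact: cvg_cst|exact: cvg_id].
near=> x.
apply: (lt_le_trans _ (smooth_difference_quotient x v h0)).
by near: x; exact: (cvgr_gt _ qc).
Unshelve. all: by end_near. Qed.

(** The one-sided quadratic bound does not make the gradient Lipschitz, but it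
    makes it continuous: lower semicontinuity in the directions [v] and [- v]
    is lower and upper semicontinuity in the direction [v]. *)
Lemma smooth_grad_continuous (v : 'rV[R]_d) :
  continuous (fun x => dotp (grad f x) v).
Proof.
move=> y; apply/(cvgrPdist_lt (F := nbhs y)) => e e0; near=> x.
rewrite ltr_distlC; apply/andP; split.
  by near: x; exact: grad_lower_semicontinuous.
rewrite -ltrN2 opprD -!dotpNr.
by near: x; exact: grad_lower_semicontinuous.
Unshelve. all: by end_near. Qed.

Lemma smooth_grad_coord_continuous i : continuous (fun x => grad f x 0 i).
Proof.
have -> : (fun x => grad f x 0 i) = (fun x => dotp (grad f x) (delta_mx 0 i)).
  by apply/funext => x; rewrite mxE derive_dotp.
exact: smooth_grad_continuous.
Qed.

End SmoothGradient.

(** * Measurability of continuous functions of vectors *)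

Section CoordMeasurable.
Context {R : realType} {d : nat} {disp : measure_display}
  {T : measurableType disp}.
Local Notation V := 'rV[R]_d.

Definition coord_measurable (g : T -> V) :=
  forall i, measurable_fun setT (fun x => g x 0 i).

Lemma open_rational_box (U : set V) (x : V) : open U -> U x ->
  exists qr : 'rV[rat]_d * rat,
    let box := [set y : V | forall i, `|y 0 i - ratr (qr.1 0 i)| < ratr qr.2] in
    box x /\ box `<=` U.
Proof.
move=> oU Ux; have /nbhs_ballP[e /= e0 eU] := open_nbhs_nbhs (conj oU Ux).
have /rat_in_itvoo[r /[!in_itv] /= /andP[r0 re]] : 0 < e / 2 by rewrite divr_gt0.
have close i : exists q : rat, `|x 0 i - ratr q| < ratr r.
  have /rat_in_itvoo[q /[!in_itv] /= /andP[q1 q2]] :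
      x 0 i - ratr r < x 0 i + ratr r.
    by rewrite ltrD2l gtrN.
  by exists q; rewrite distrC ltr_distl q1.
have [q qP] := choice close.
exists (\row_i q i, r); split => /= [i|y yP]; first by rewrite mxE.
apply: eU; split => // i j; rewrite !ord1.
apply: (le_lt_trans (ler_distD (ratr (q j)) _ _)).
rewrite [ltRHS]splitr; apply: ltrD; first exact: lt_trans (qP j) re.
by have := yP j; rewrite mxE distrC => /lt_trans; apply.
Qed.

(** An open set is a countable union of boxes with rational centre and size. *)
Lemma measurable_preimage_open (g : T -> V) (U : set V) :
  coord_measurable g -> open U -> measurable (g @^-1` U).
Proof.
move=> mg oU.
pose box (qr : 'rV[rat]_d * rat) : set V :=
  [set y : V | forall i, `|y 0 i - ratr (qr.1 0 i)| < ratr qr.2].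
have -> : g @^-1` U = \bigcup_(qr in [set qr | box qr `<=` U]) (g @^-1` box qr).
  apply/seteqP; split => [t Ut|t [qr /= sub gt]]; last exact: sub.
  by have [qr [? ?]] := open_rational_box oU Ut; exists qr.
rewrite bigcup_mkcond; apply: countable_bigcupT_measurable => // qr.
case: ifP => // _.
have -> : g @^-1` box qr = \bigcap_(i in [set: 'I_d])
    (fun t => `|g t 0 i - ratr (qr.1 0 i)|) @^-1` `]-oo, ratr qr.2[.
  apply/seteqP; split => [t bt i _|t bt i] /=; first by rewrite in_itv; exact: bt.
  by have := bt i I; rewrite /= in_itv.
apply: fin_bigcap_measurable => // i _; rewrite -[X in measurable X]setTI.
suff : measurable_fun setT (fun t => `|g t 0 i - ratr (qr.1 0 i)|).
  by apply => //; exact: measurable_itv.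
by apply: measurableT_comp => //; apply: measurable_funB => //; exact: mg.
Qed.

Lemma measurable_continuous_comp (g : T -> V) (phi : V -> R) :
  coord_measurable g -> continuous phi -> measurable_fun setT (phi \o g).
Proof.
move=> mg /continuousP cphi.
apply: (measurability _ (RGenOpens.measurableE R)) => _ [_ [a [b ->]] <-].
rewrite setTI comp_preimage; apply: measurable_preimage_open => //.
exact/cphi/interval_open.
Qed.

End CoordMeasurable.

(** * Integration against a measure with a density *)

Section Density.
Context {disp : measure_display} {T : measurableType disp} {R : realType}.
Variables (nu mu : {measure set T -> \bar R}) (p : T -> R).
Hypothesis mp : measurable_fun setT p.
Hypothesis p0 : forall x, 0 <= p x.
Hypothesis nuE : forall A, measurable A -> nu A = (\int[mu]_(x in A) (p x)%:E)%E.
Import HBNNSimple.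
Local Open Scope ereal_scope.

Lemma ge0_integral_density (g : T -> \bar R) :
  measurable_fun setT g -> (forall x, 0 <= g x) ->
  \int[nu]_x g x = \int[mu]_x (g x * (p x)%:E).
Proof.
move=> mg g0; pose h := nnsfun_approx measurableT mg.
have gE x : g x = limn (EFin \o h^~ x).
  by apply/esym/cvg_lim => //; exact: cvg_nnsfun_approx.
have mpE : measurable_fun setT (EFin \o p) by exact/measurable_EFinP.
have -> : \int[nu]_x g x = limn (fun n => \int[nu]_x (h n x)%:E).
  under eq_integral do rewrite gE.
  apply: monotone_convergence => //.
  - by move=> n; exact/measurable_EFinP.
  - by move=> n x _; rewrite lee_fin.
  - by move=> x _ a b ab; rewrite lee_fin; exact/lefP/nd_nnsfun_approx.
have -> : \int[mu]_x (g x * (p x)%:E) =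
    limn (fun n => \int[mu]_x ((h n x)%:E * (p x)%:E)).
  have gpE x : g x * (p x)%:E = limn (fun n => (h n x)%:E * (p x)%:E).
    apply/esym/cvg_lim => //; apply: cvgeZr => //.
    exact: cvg_nnsfun_approx.
  under eq_integral do rewrite gpE.
  apply: monotone_convergence => //.
  - by move=> n; apply: emeasurable_funM => //; exact/measurable_EFinP.
  - by move=> n x _; rewrite mule_ge0 ?lee_fin.
  - move=> x _ a b ab; rewrite lee_wpmul2r ?lee_fin //.
    exact/lefP/nd_nnsfun_approx.
suff hE n : \int[nu]_x (h n x)%:E = \int[mu]_x ((h n x)%:E * (p x)%:E).
  by under eq_fun do rewrite hE.
rewrite integralT_nnsfun sintegralE.
under [RHS]eq_integral => x _.
  rewrite fimfunE -fsumEFin // ge0_mule_fsuml; last first.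
    by move=> y; exact: nnfun_muleindic_ge0.
  over.
rewrite ge0_integral_fsum //; last 2 first.
- by move=> r; apply: emeasurable_funM => //; exact/measurable_EFinP/measurable_funM.
- by move=> r x _; rewrite mule_ge0 ?nnfun_muleindic_ge0 ?lee_fin.
apply: eq_fsbigr => r /[!inE] -[x _ <-{r}].
under eq_integral do rewrite EFinM -muleA.
rewrite ge0_integralZl //; last 3 first.
- by apply: emeasurable_funM => //; exact/measurable_EFinP.
- by move=> y _; rewrite mule_ge0 ?lee_fin.
- by rewrite lee_fin.
congr (_ * _); rewrite nuE // integral_mkcond; apply: eq_integral => y _.
by rewrite patchE indicE; case: ifP => _; rewrite ?mul1e ?mul0e.
Qed.

End Density.

(** * Independence and iterated integrals *)

Section IndependentPair.
Context {d d1 d2 : measure_display} {Omega : measurableType d}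
  {S1 : measurableType d1} {S2 : measurableType d2} {R : realType}
  (P : probability Omega R) (X : {RV P >-> S1}) (Y : {RV P >-> S2}).
Local Open Scope ereal_scope.

Hypothesis XY : forall A B, measurable A -> measurable B ->
  P (X @^-1` A `&` Y @^-1` B) = P (X @^-1` A) * P (Y @^-1` B).

(** The law of an independent pair is the product of the laws, by uniqueness of
    the product measure, so Tonelli applies. *)
Lemma ge0_integral_independent (F : S1 * S2 -> \bar R) :
  measurable_fun setT F -> (forall p, 0 <= F p) ->
  \int[P]_omega F (X omega, Y omega) =
  \int[P]_omega \int[distribution P Y]_u F (X omega, u).
Proof.
move=> mF F0.
have mXY : measurable_fun setT (fun omega => (X omega, Y omega)).
  by apply/measurable_fun_pairP; split; exact: measurable_funPT.
pose XYmix := isMeasurableFun.Build _ _ _ _ _ mXY.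
pose Z : {RV P >-> (S1 * S2)%type} := HB.pack (fun omega => (X omega, Y omega)) XYmix.
have lawZ A : measurable A ->
    (distribution P X \x distribution P Y) A = distribution P Z A.
  apply: product_measure_unique => B C mB mC.
  by rewrite /distribution /pushforward -XY.
transitivity (\int[distribution P Z]_p F p).
  by rewrite ge0_integral_distribution.
transitivity (\int[distribution P X \x distribution P Y]_p F p).
  by apply: eq_measure_integral => A mA _; exact/esym/lawZ.
rewrite fubini_tonelli1 // ge0_integral_distribution //.
  exact: measurable_fun_fubini_tonelli_F.
by move=> x; exact: integral_ge0.
Qed.

End IndependentPair.

Section PiSystem.
Context {d : measure_display} {Omega : measurableType d} {R : realType}
  (P : probability Omega R) (G : set (set Omega)).
Hypothesis Gm : G `<=` measurable.
Hypothesis GT : G setT.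
Hypothesis GI : setI_closed G.
Local Open Scope ereal_scope.

(** Both sides are finite measures in [A] that agree on a pi-system. *)
Lemma independent_pi_system (E : set Omega) : measurable E ->
  (forall C, G C -> P (C `&` E) = P C * P E) ->
  forall A, <<s G >> A -> P (A `&` E) = P A * P E.
Proof.
move=> mE GE A GA.
have PE0 : (0 <= fine (P E))%R by rewrite fine_ge0 // measure_ge0.
pose m2 := mscale (NngNum PE0) P.
have PEE : (fine (P E))%:E = P E by rewrite fineK // fin_num_measure.
have -> : P (A `&` E) = mrestr P mE A by [].
have -> : P A * P E = m2 A by rewrite /m2 /mscale /= PEE muleC.
apply: (@g_sigma_algebra_measure_unique _ _ _ G Gm (fun=> setT)) => //.
- by apply/seteqP; split => // x _; exists 0%N.
- move=> C GC; transitivity (P C * P E); first exact: GE.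
  by rewrite /m2 /= /mscale /= PEE muleC.
- move=> _; rewrite /= /mrestr setTI; exact: le_lt_trans (probability_le1 _ mE) (ltry _).
Qed.

Lemma measurable_id_g_sigma : measurable_fun setT (id : Omega -> g_sigma_algebraType G).
Proof.
move=> _ A mA; rewrite setTI preimage_id.
by apply: (smallest_sub (@sigma_algebra_measurable _ Omega) Gm).
Qed.

(** Here the outcome [omega] itself, observed through the sigma-algebra generated
    by [G], plays the part of the first variable of the independent pair.  This
    conditions on the past without a space of histories. *)
Lemma ge0_integral_independent_pi_system d2 (S2 : measurableType d2)
    (Y : {RV P >-> S2}) (F : g_sigma_algebraType G * S2 -> \bar R) :
  (forall C B, G C -> measurable B ->
    P (C `&` Y @^-1` B) = P C * P (Y @^-1` B)) ->
  measurable_fun setT F -> (forall p, 0 <= F p) ->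
  \int[P]_omega F (omega, Y omega) =
  \int[P]_omega \int[distribution P Y]_u F (omega, u).
Proof.
move=> CY mF F0.
pose idmix := isMeasurableFun.Build _ _ _ _ _ measurable_id_g_sigma.
pose X : {RV P >-> g_sigma_algebraType G} := HB.pack (id : Omega -> g_sigma_algebraType G) idmix.
apply: (ge0_integral_independent (X := X) (Y := Y)) => // A B mA mB.
apply: independent_pi_system => //.
  by rewrite -[X in measurable X]setTI; exact: measurable_funPT.
by move=> C GC; exact: CY.
Qed.

End PiSystem.

(** * The flow, the jumps and the Lyapunov function *)

Section Dynamics.
Context {R : realType} {d : nat}.
Local Notation V := 'rV[R]_d.
Implicit Types (f : V -> R) (x : V * V).

(** The fraction of the segment from [w] to [z] that [w] covers in time [u].  It
    increases to [1 / (1 + rho)]: the relative speeds of [w] and [z] are 1 and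
    [rho], and the two points meet in the limit. *)
Definition mixing (s rho u : R) : R :=
  (1 - expR (- ((1 + rho) * s * u))) / (1 + rho).

(** The solution of [w' = s (z - w)], [z' = rho s (w - z)] started at [x], in
    closed form. *)
Definition flow (s rho : R) x (u : R) : V * V :=
  (x.1 + mixing s rho u *: (x.2 - x.1),
   x.2 + (rho * mixing s rho u) *: (x.1 - x.2)).

Definition gradient_jump f (g g' : R) x : V * V :=
  (x.1 - g *: grad f x.1, x.2 - g' *: grad f x.1).

Definition lyapunov f (wstar : V) (mu : R) x : R :=
  f x.1 - f wstar + mu / 2 * enorm (x.2 - wstar) ^+ 2.

Lemma subZ_coord (a b : V) (g : R) i : (a - g *: b) 0 i = a 0 i - g * b 0 i.
Proof. by rewrite !mxE. Qed.

Lemma mixing0 s rho : mixing s rho 0 = 0.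
Proof. by rewrite /mixing mulr0 oppr0 expR0 subrr mul0r. Qed.

Lemma flow0 s rho x : flow s rho x 0 = x.
Proof. by case: x => w z; rewrite /flow mixing0 mulr0 !scale0r !addr0. Qed.

Lemma flow_sub (s rho : R) x (u : R) : 0 < rho -> (flow s rho x u).2 - (flow s rho x u).1 =
  expR (- ((1 + rho) * s * u)) *: (x.2 - x.1).
Proof.
move=> rho0; apply/rowP => i; rewrite !mxE /mixing.
by field; rewrite gt_eqF // ltr_wpDl.
Qed.

Lemma is_derive_mixing (s rho u : R) : 0 < rho ->
  is_derive u 1 (mixing s rho) (s * expR (- ((1 + rho) * s * u))).
Proof.
move=> rho0; rewrite /mixing.
have dlin : is_derive u 1 (fun u => - ((1 + rho) * s * u)) (- ((1 + rho) * s)).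
  apply: is_derive_eq; rewrite /GRing.scale /=; ring.
have dexp : is_derive u 1 (fun u => expR (- ((1 + rho) * s * u)))
    (expR (- ((1 + rho) * s * u)) * (- ((1 + rho) * s))).
  exact: (is_derive1_comp (f := expR)).
apply: is_derive_eq; rewrite /GRing.scale /=.
by field; rewrite gt_eqF // ltr_wpDl.
Qed.

Lemma mixing_continuous (s rho : R) : 0 < rho -> continuous (mixing s rho).
Proof.
move=> rho0 u; apply: differentiable_continuous; apply/derivable1_diffP.
by have dm := is_derive_mixing s u rho0; exact: ex_derive.
Qed.

Lemma flow_continuous (s rho : R) x : 0 < rho ->
  continuous (fun u => (flow s rho x u).1) /\
  continuous (fun u => (flow s rho x u).2).
Proof.
move=> rho0; split => u; apply: cvgD; try exact: cvg_cst; apply: cvgZr_tmp.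
  exact: mixing_continuous.
by apply: cvgMl_tmp; exact: mixing_continuous.
Qed.

End Dynamics.

Section Lyapunov.
Context {R : realType} {d : nat} (f : 'rV[R]_d -> R) (wstar : 'rV[R]_d)
  (L rho mu : R).
Local Notation V := 'rV[R]_d.
Implicit Types x : V * V.
Hypotheses (L0 : 0 < L) (rho0 : 0 < rho) (mu0 : 0 < mu).
Hypothesis df : forall y, differentiable f y.
Hypothesis fmin : global_minimizer f wstar.
Hypothesis fL : smooth L f.
Hypothesis fsqc : strongly_quasar_convex rho mu f wstar.

Local Notation s := (Num.sqrt (mu / L)).
Local Notation energy := (lyapunov f wstar mu).
Local Notation fl := (flow s rho).
Local Notation jump := (gradient_jump f (1 / L) (1 / Num.sqrt (mu * L))).

Lemma rate_gt0 : 0 < s.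
Proof. by rewrite sqrtr_gt0 divr_gt0. Qed.

Lemma lyapunov_ge0 x : 0 <= energy x.
Proof.
rewrite addr_ge0 ?subr_ge0 ?fmin // mulr_ge0 ?sqr_ge0 //.
by rewrite divr_ge0 // ltW.
Qed.

Lemma le_lyapunov x : f x.1 - f wstar <= energy x.
Proof. by rewrite lerDl mulr_ge0 ?sqr_ge0 // divr_ge0 // ltW. Qed.

Lemma sqrt_mulL : Num.sqrt (mu * L) = s * L.
Proof.
have -> : mu * L = mu / L * L ^+ 2 by field; rewrite gt_eqF.
by rewrite sqrtrM ?divr_ge0 ?ltW // sqrtr_sqr gtr0_norm.
Qed.

(** The gradient step in [w] gains [|grad f w| ^ 2 / (2 L)] by smoothness, and
    expanding the square in [z] loses exactly as much because
    [mu / 2 * (1 / sqrt (mu L)) ^ 2 = 1 / (2 L)]; the cross term remains. *)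
Lemma lyapunov_jump x :
  energy (jump x) <= energy x - s * dotp (grad f x.1) (x.2 - wstar).
Proof.
have s2 : s ^+ 2 * L = mu.
  by rewrite sqr_sqrtr ?divr_ge0 ?ltW // divfK // gt_eqF.
have s0 := rate_gt0.
have := fL (x.1 - (1 / L) *: grad f x.1) x.1.
rewrite /lyapunov /= !enorm_sqr sqrt_mulL !dotpE.
set G := dotp (grad f x.1) (grad f x.1).
rewrite ![dotp _ (grad f x.1)]dotpC.
(* With [mu] eliminated in favour of [s ^+ 2 * L], the slack of the inequality
   is the slack of the smoothness bound. *)
set r := s in s0 s2 *; clearbody r; rewrite -s2 -subr_ge0 => slack.
rewrite -subr_ge0; apply: (le_trans slack); rewrite le_eqVlt; apply/orP; left.
apply/eqP; field; rewrite !gt_eqF //.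
Qed.

(** The left-hand side is the rate of change of the Lyapunov function when the
    flow and unit-rate jumps act together.  The two gradient terms combine to
    [s <grad f w, wstar - w>], which quasar convexity bounds; the slack is
    [rho s] times the slack of quasar convexity plus
    [mu rho s / 2 * |w - z| ^ 2]. *)
Lemma dissipation x :
  s * dotp (grad f x.1) (x.2 - x.1)
  + mu * rho * s * dotp (x.2 - wstar) (x.1 - x.2)
  - s * dotp (grad f x.1) (x.2 - wstar) <= - (rho * s * energy x).
Proof.
have s0 := rate_gt0.
have := fsqc x.1; rewrite -subr_ge0 => /(mulr_ge0 (ltW (mulr_gt0 rho0 s0))).
have : 0 <= mu * rho * s / 2 * dotp (x.1 - x.2) (x.1 - x.2).
  by rewrite mulr_ge0 ?dotp_ge0 // divr_ge0 // !mulr_ge0 // ltW.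
set r := s; clearbody r; move=> /addr_ge0 /[apply] slack.
rewrite -subr_ge0; apply: (le_trans slack); rewrite le_eqVlt; apply/orP; left.
apply/eqP; rewrite /lyapunov !enorm_sqr !dotpE.
rewrite (dotpC wstar x.1) (dotpC wstar x.2) (dotpC x.2 x.1).
by field; rewrite gt_eqF.
Qed.

(** The orbit of the flow is a segment run through at speed [mixing'], so the
    chain rule is needed in one variable only. *)
Lemma is_derive_lyapunov_flow x (u : R) :
  is_derive u 1 (fun u => energy (fl x u))
    (s * dotp (grad f (fl x u).1) ((fl x u).2 - (fl x u).1)
     + mu * rho * s * dotp ((fl x u).2 - wstar) ((fl x u).1 - (fl x u).2)).
Proof.
set v := x.2 - x.1.
have dphi (y : R) : is_derive y 1 (fun y => f (x.1 + y *: v))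
    (dotp (grad f (x.1 + y *: v)) v).
  have quotE : (fun h : R => h^-1 *:
        (((fun y => f (x.1 + y *: v)) \o shift y) (h *: 1) - f (x.1 + y *: v))) =
      (fun h => h^-1 *: ((f \o shift (x.1 + y *: v)) (h *: v) - f (x.1 + y *: v))).
    apply/funext => h /=; congr (_ *: (f _ - _)).
    by rewrite [h *: 1]mulr1 scalerDl addrCA.
  have : derivable f (x.1 + y *: v) v by exact: diff_derivable.
  rewrite /derivable -quotE => dline.
  by apply: DeriveDef => //; rewrite /derive quotE; exact: derive_dotp.
have dquad (y : R) : is_derive y 1
   (fun y => mu / 2 * enorm (x.2 + (rho * y) *: (x.1 - x.2) - wstar) ^+ 2)
   (mu * rho * dotp (x.2 + (rho * y) *: (x.1 - x.2) - wstar) (x.1 - x.2)).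
  have -> : (fun y => mu / 2 * enorm (x.2 + (rho * y) *: (x.1 - x.2) - wstar) ^+ 2) =
      fun y => mu / 2 * (dotp (x.2 - wstar) (x.2 - wstar)
        + 2 * rho * dotp (x.2 - wstar) (x.1 - x.2) * y
        + rho ^+ 2 * dotp (x.1 - x.2) (x.1 - x.2) * y ^+ 2).
    apply/funext => t; rewrite enorm_sqr addrAC; move: (x.2 - wstar) (x.1 - x.2).
    by move=> p q; rewrite !dotpE (dotpC q p); ring.
  apply: is_derive_eq; rewrite addrAC; move: (x.2 - wstar) (x.1 - x.2) => p q.
  by rewrite !dotpE /GRing.scale /=; field.
have dmix := is_derive_mixing s u rho0.
pose psi y := f (x.1 + y *: v) - f wstar
  + mu / 2 * enorm (x.2 + (rho * y) *: (x.1 - x.2) - wstar) ^+ 2.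
have dpsi (y : R) : is_derive y 1 psi (dotp (grad f (x.1 + y *: v)) v
    + mu * rho * dotp (x.2 + (rho * y) *: (x.1 - x.2) - wstar) (x.1 - x.2)).
  rewrite /psi; apply: is_derive_eq; by rewrite subr0.
have dcomp := is_derive1_comp (dpsi (mixing s rho u)) dmix.
apply: (is_derive_eq dcomp).
rewrite -(opprB (fl x u).2 (fl x u).1) flow_sub // -(opprB x.2 x.1) -/v.
by rewrite !dotpE /=; ring.
Qed.

Section Measurability.
Context {disp : measure_display} {T : measurableType disp}.
Implicit Types (X : T -> V * V) (u : T -> R).

Definition state_measurable X :=
  coord_measurable (fst \o X) /\ coord_measurable (snd \o X).

Lemma measurable_flow X u : state_measurable X -> measurable_fun setT u ->
  state_measurable (fun t => fl (X t) (u t)).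
Proof.
move=> [mX1 mX2] mu_.
have mmix : measurable_fun setT (fun t => mixing s rho (u t)).
  by apply: measurableT_comp => //; apply: continuous_measurable_fun; exact: mixing_continuous.
split => i; rewrite /=.
  under eq_fun do rewrite !mxE.
  apply: measurable_funD; first exact: mX1.
  apply: measurable_funM => //; apply: measurable_funB; [exact: mX2|exact: mX1].
under eq_fun do rewrite !mxE.
apply: measurable_funD; first exact: mX2.
apply: measurable_funM; first exact: measurable_funM.
by apply: measurable_funB; [exact: mX1|exact: mX2].
Qed.

Lemma measurable_jump X : state_measurable X ->
  state_measurable (fun t => jump (X t)).
Proof.
move=> [mX1 mX2].
have mgrad i : measurable_fun setT (fun t => grad f (X t).1 0 i).
  apply: (measurable_continuous_comp (phi := fun y => grad f y 0 i) mX1).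
  exact: smooth_grad_coord_continuous.
split => i; rewrite /=; under eq_fun do rewrite subZ_coord.
- by apply: measurable_funB; [exact: mX1|exact: measurable_funM].
- by apply: measurable_funB; [exact: mX2|exact: measurable_funM].
Qed.

Lemma measurable_objective (g : T -> V) : coord_measurable g ->
  measurable_fun setT (fun t => f (g t)).
Proof.
move=> mg; apply: (measurable_continuous_comp (phi := f) mg).
by move=> y; exact: differentiable_continuous.
Qed.

Lemma measurable_lyapunov X : state_measurable X ->
  measurable_fun setT (fun t => energy (X t)).
Proof.
move=> [mX1 mX2]; apply: measurable_funD.
  by apply: measurable_funB => //; exact: measurable_objective.
apply: measurable_funM => //; under eq_fun do rewrite enorm_sqr.
apply: measurable_sum => i; under eq_fun do rewrite !mxE.
by apply: measurable_funM; apply: measurable_funB => //; exact: mX2.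
Qed.

End Measurability.

(** [discount] collects the growth rate [rho * s] of the weight in the theorem
    and the rate 1 at which the exponential waiting time ends. *)
Local Notation discount := (rho * s - 1).

(** Minus the derivative of the discounted energy along the flow. *)
Definition dissipated x (u : R) : R :=
  - (expR (discount * u) * (discount * energy (fl x u)
     + (s * dotp (grad f (fl x u).1) ((fl x u).2 - (fl x u).1)
        + mu * rho * s * dotp ((fl x u).2 - wstar) ((fl x u).1 - (fl x u).2)))).

Lemma is_derive_discounted_lyapunov x (u : R) :
  is_derive u 1 (fun u => expR (discount * u) * energy (fl x u)) (- dissipated x u).
Proof.
have dE := is_derive_lyapunov_flow x u.
have dlin : is_derive u 1 (fun u => discount * u) discount.
  by apply: is_derive_eq; rewrite /GRing.scale /=; ring.
have dexp : is_derive u 1 (fun u => expR (discount * u))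
    (expR (discount * u) * discount).
  exact: (is_derive1_comp (f := expR)).
by apply: is_derive_eq; rewrite /dissipated /GRing.scale /=; ring.
Qed.

Lemma jump_le_dissipated x (u : R) :
  expR (discount * u) * energy (jump (fl x u)) <= dissipated x u.
Proof.
rewrite /dissipated -mulrN ler_pM2l ?expR_gt0 //.
have := lyapunov_jump (fl x u); have := dissipation (fl x u).
by lra.
Qed.

(** Continuity of the gradient enters here: it is what the fundamental theorem
    of calculus requires in [flow_energy_integral]. *)
Lemma dissipated_continuous x : continuous (dissipated x).
Proof.
set v := x.2 - x.1.
pose e u := expR (- ((1 + rho) * s * u)).
have -> : dissipated x = fun u =>
    - (expR (discount * u) * (discount * energy (fl x u)
     + (s * (e u * dotp (grad f (fl x u).1) v)
        - mu * rho * s * (e u * (dotp (x.2 - wstar) v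
            - rho * mixing s rho u * dotp v v))))).
  apply/funext => u; rewrite /dissipated.
  rewrite -(opprB (fl x u).2 (fl x u).1) flow_sub // -/v -/(e u).
  by rewrite /= -(opprB x.2 x.1) -/v !dotpE; congr (- (_ * (_ + _))); ring.
have ce : continuous e.
  move=> u; apply: continuous_comp; last exact: continuous_expR.
  by apply: cvgN; apply: cvgM; [exact: cvg_cst|exact: cvg_id].
have cexp : continuous (fun u : R => expR (discount * u)).
  move=> u; apply: continuous_comp; last exact: continuous_expR.
  by apply: cvgM; [exact: cvg_cst|exact: cvg_id].
have cE : continuous (fun u => energy (fl x u)).
  move=> u; apply: differentiable_continuous; apply/derivable1_diffP.
  by have dE := is_derive_lyapunov_flow x u; exact: ex_derive.
have [cw _] := flow_continuous s x rho0.
have cg : continuous (fun u => dotp (grad f (fl x u).1) v).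
  move=> u; apply: (continuous_comp (f := fun u => (fl x u).1)
    (g := fun y => dotp (grad f y) v)); first exact: cw.
  exact: smooth_grad_continuous.
move=> u; apply: cvgN; apply: cvgM; first exact: cexp.
apply: cvgD; first by apply: cvgMl_tmp; exact: cE.
apply: cvgB; first by apply: cvgMl_tmp; apply: cvgM; [exact: ce|exact: cg].
apply: cvgMl_tmp; apply: cvgM; first exact: ce.
apply: cvgB; first exact: cvg_cst.
by apply: cvgMr_tmp; apply: cvgMl_tmp; exact: mixing_continuous.
Qed.

Lemma measurable_discounted_jump x : measurable_fun setT
  (fun u => expR (discount * u) * energy (jump (fl x u))).
Proof.
apply: measurable_funM.
  by apply: measurableT_comp => //; exact: measurable_funM.
apply: measurable_lyapunov; apply: measurable_jump.
by apply: measurable_flow => //; split => i /=; exact: measurable_cst.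
Qed.

(** Integrating [jump_le_dissipated] from 0 to [r] gives the energy balance
    between two jumps. *)
Lemma flow_energy_integral x (r : R) : 0 <= r ->
  (\int[lebesgue_measure]_(u in `[0%R, r])
      (expR (discount * u) * energy (jump (fl x u)))%:E
   + (expR (discount * r) * energy (fl x r))%:E <= (energy x)%:E)%E.
Proof.
move=> r0; have [->|rneq] := eqVneq r 0.
  by rewrite set_itv1 integral_set1 add0e mulr0 expR0 mul1r flow0.
have {rneq}r0 : 0 < r by rewrite lt_def rneq.
rewrite -leeBrDr // -EFinB.
pose H u := - (expR (discount * u) * energy (fl x u)).
have dH (u : R) : is_derive u 1 H (dissipated x u).
  by have := is_derive_discounted_lyapunov x u => ?; apply: is_derive_eq; rewrite opprK.
have Hcont : continuous H.
  by move=> u; apply: differentiable_continuous; apply/derivable1_diffP; exact: ex_derive.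
have FTC : (\int[lebesgue_measure]_(u in `[0%R, r]) (dissipated x u)%:E
    = (H r)%:E - (H 0)%:E)%E.
  apply: continuous_FTC2 => //.
  - by apply: continuous_subspaceT; exact: dissipated_continuous.
  - split.
    + by move=> u _; exact: ex_derive.
    + by apply: cvg_at_right_filter; exact: Hcont.
    + by apply: cvg_at_left_filter; exact: Hcont.
  - by move=> u _; rewrite derive1E; exact: derive_val.
have -> : (energy x - expR (discount * r) * energy (fl x r))%:E
    = (\int[lebesgue_measure]_(u in `[0%R, r]) (dissipated x u)%:E)%E.
  rewrite FTC -EFinB /H mulr0 expR0 mul1r flow0 opprK addrC //.
apply: ge0_le_integral => //.
- by move=> u _; rewrite lee_fin mulr_ge0 ?expR_ge0 ?lyapunov_ge0.
- by apply/measurable_EFinP/measurable_funTS; exact: measurable_discounted_jump.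
- apply/measurable_EFinP/measurable_funTS; apply: continuous_measurable_fun.
  exact: dissipated_continuous.
- by move=> u _; rewrite lee_fin jump_le_dissipated.
Qed.

End Lyapunov.

(** * Exponential waiting times *)

Section Exponential.
Context {R : realType}.
Local Notation leb := (@lebesgue_measure R).
Local Open Scope ereal_scope.

Lemma integral_exponential_law (nu : {measure set (measurableTypeR R) -> \bar R})
    (G : measurableTypeR R -> \bar R) :
  (forall A, measurable A -> nu A = exponential_prob 1 A) ->
  measurable_fun setT G -> (forall u, 0 <= G u) ->
  \int[nu]_u G u = \int[leb]_(u in `[0%R, +oo[) (G u * (expR (- u))%:E).
Proof.
move=> nuE mG G0.
have pdf0 u : (0 <= @exponential_pdf R 1 u)%R by exact: exponential_pdf_ge0.
rewrite (ge0_integral_density (nu := nu) (mu := leb) (@measurable_exponential_pdf R 1) pdf0 nuE) //.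
rewrite [RHS]integral_mkcond; apply: eq_integral => u _.
rewrite patchE /exponential_pdf patchE; case: ifP => _; last by rewrite mule0.
by rewrite mul1r mulN1r.
Qed.

Lemma measurable_expRN : measurable_fun setT (fun u : R => expR (- u)).
Proof. by apply: measurableT_comp => //; exact: measurable_funN. Qed.

Lemma exponential_tail (r : R) : \int[leb]_(u in `]r, +oo[) (expR (- u))%:E = (expR (- r))%:E.
Proof.
have ce : continuous (fun u : R => expR (- u)).
  by move=> u; apply: continuous_comp; [apply: cvgN; exact: cvg_id|exact: continuous_expR].
have dE (u : R) : is_derive u 1%R (fun u => - expR (- u))%R (expR (- u))%R.
  have dN : is_derive u 1%R (fun u : R => expR (- u))%R (expR (- u) * -1)%R.
    exact: (is_derive1_comp (f := expR)).
  by apply: is_derive_eq; rewrite mulrN1 opprK.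
rewrite integral_itv_obnd_cbnd; last first.
  by apply/measurable_EFinP/measurable_funTS; exact: continuous_measurable_fun.
rewrite (@ge0_continuous_FTC2y _ _ (fun u => - expR (- u))%R _ 0%R).
- by rewrite EFinN oppeK add0e.
- by move=> u _; exact: expR_ge0.
- exact: (@continuous_subspaceT R R).
- by rewrite -oppr0; apply: cvgN; exact: cvgr_expR.
- by move=> u _; exact: ex_derive.
- by apply: cvg_at_right_filter; apply: cvgN; exact: ce.
- by move=> u _; rewrite derive1E; exact: derive_val.
Qed.

End Exponential.

(** * Energy balance of one waiting time *)

Section Step.
Context {R : realType} {d : nat} (f : 'rV[R]_d -> R) (wstar : 'rV[R]_d)
  (L rho mu : R).
Local Notation V := 'rV[R]_d.
Implicit Types x : V * V.
Hypotheses (L0 : 0 < L) (rho0 : 0 < rho) (mu0 : 0 < mu).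
Hypothesis df : forall y, differentiable f y.
Hypothesis fmin : global_minimizer f wstar.
Hypothesis fL : smooth L f.
Hypothesis fsqc : strongly_quasar_convex rho mu f wstar.

Local Notation s := (Num.sqrt (mu / L)).
Local Notation energy := (lyapunov f wstar mu).
Local Notation fl := (flow s rho).
Local Notation jump := (gradient_jump f (1 / L) (1 / Num.sqrt (mu * L))).
Local Notation leb := (@lebesgue_measure R).

(** The weighted energy at a jump time [S], counted only if the jump occurs before
    the horizon [t]. *)
Definition energy_at_jump (t S : R) x : R :=
  if S <= t then expR (rho * s * S) * energy x else 0.

(** The weighted energy at the horizon [t], counted only if [t] falls in the
    waiting time [u] that follows the jump at time [S]. *)
Definition energy_between (t S : R) x (u : R) : R :=
  if (S <= t) && (t < S + u) then expR (rho * s * t) * energy (fl x (t - S))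
  else 0.

Lemma energy_at_jump_ge0 t S x : 0 <= energy_at_jump t S x.
Proof.
by rewrite /energy_at_jump; case: ifP => // _; rewrite mulr_ge0 ?expR_ge0 ?lyapunov_ge0.
Qed.

Lemma energy_between_ge0 t S x u : 0 <= energy_between t S x u.
Proof.
by rewrite /energy_between; case: ifP => // _; rewrite mulr_ge0 ?expR_ge0 ?lyapunov_ge0.
Qed.

Section Measurability.
Context {disp : measure_display} {T : measurableType disp}.

Lemma measurable_energy_at_jump t (S : T -> R) (X : T -> V * V) :
  measurable_fun setT S -> state_measurable X ->
  measurable_fun setT (fun omega => energy_at_jump t (S omega) (X omega)).
Proof.
move=> mS mX; apply: measurable_fun_ifT => //.
  exact: measurable_fun_ler.
apply: measurable_funM; last by apply: measurable_lyapunov.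
by apply: measurableT_comp => //; exact: measurable_funM.
Qed.

Lemma measurable_energy_between t (S u : T -> R) (X : T -> V * V) :
  measurable_fun setT S -> measurable_fun setT u -> state_measurable X ->
  measurable_fun setT
    (fun omega => energy_between t (S omega) (X omega) (u omega)).
Proof.
move=> mS mu_ mX; apply: measurable_fun_ifT => //.
  apply: measurable_and; first exact: measurable_fun_ler.
  by apply: measurable_fun_ltr => //; exact: measurable_funD.
apply: measurable_funM => //; apply: measurable_lyapunov => //.
by apply: measurable_flow => //; exact: measurable_funB.
Qed.

End Measurability.

Local Open Scope ereal_scope.

(** Split the waiting time at [r = t - S].  If the next jump comes before [r], the
    energy is collected at that jump; otherwise it is collected at the horizon,
    with probability [exp (- r)].  The total is the left-hand side of
    [flow_energy_integral] multiplied by [exp (rho s S)]. *)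
Lemma one_step_energy t S x :
  \int[leb]_(u in `[0%R, +oo[)
    ((energy_between t S x u + energy_at_jump t (S + u) (jump (fl x u)))%:E
      * (expR (- u))%:E) <= (energy_at_jump t S x)%:E.
Proof.
(* A jump after the horizon cannot be followed by one before it, because
   waiting times are nonnegative. *)
have [St|tS] := leP S t; last first.
  rewrite integral0_eq ?lee_fin ?energy_at_jump_ge0 // => u; rewrite /= in_itv /= andbT => u0.
  rewrite /energy_between /energy_at_jump !leNgt tS /=.
  by rewrite (lt_le_trans tS) ?lerDl // addr0 mul0e.
pose r := (t - S)%R; have r0 : (0 <= r)%R by rewrite subr_ge0.
have -> : (energy_at_jump t S x)%:E = (expR (rho * s * S))%:E * (energy x)%:E.
  by rewrite /energy_at_jump St EFinM.
pose F u := ((energy_between t S x u + energy_at_jump t (S + u) (jump (fl x u)))%:E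
      * (expR (- u))%:E).
change (\int[leb]_(u in `[0%R, +oo[) F u <= (expR (rho * s * S))%:E * (energy x)%:E).
have F0 u : 0 <= F u.
  by rewrite mule_ge0 ?lee_fin ?expR_ge0 // addr_ge0 ?energy_between_ge0 ?energy_at_jump_ge0.
have mF : measurable_fun setT F.
  apply: emeasurable_funM; apply/measurable_EFinP; last first.
    by apply: measurableT_comp => //; exact: measurable_funN.
  apply: measurable_funD; first by apply: measurable_energy_between => //; split => i /=.
  apply: measurable_energy_at_jump; first exact: measurable_funD.
  apply: measurable_jump => //; apply: measurable_flow => //; split => i /=; exact: measurable_cst.
have before u : `[0%R, r]%classic u -> F u = (expR (rho * s * S))%:E *
    (expR ((rho * s - 1) * u) * energy (jump (fl x u)))%:E.
  rewrite /= in_itv /= => /andP[u0 ur]; rewrite /F /energy_between /energy_at_jump.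
  rewrite -ltrBlDl ltNge ur andbF add0r -lerBrDl ur -!EFinM mulrAC mulrA -!expRD.
  by congr (expR _ * _)%:E; ring.
have after u : `]r, +oo[%classic u -> F u =
    (expR (rho * s * S) * (expR (rho * s * r) * energy (fl x r)))%:E * (expR (- u))%:E.
  rewrite /= in_itv /= andbT => ru; rewrite /F /energy_between /energy_at_jump.
  rewrite -ltrBlDl ru St -lerBrDl leNgt ru addr0 mulrA -expRD.
  by congr ((expR _ * _)%:E * _); rewrite /r; ring.
have -> : `[0%R, +oo[%classic = `[0%R, r]%classic `|` `]r, +oo[%classic.
  by rewrite -itv_bndbnd_setU // bnd_simp.
rewrite ge0_integral_setU //; last 2 first.
- exact: measurable_funTS.
- apply/eqP; rewrite -subset0 => u [] /=; rewrite !in_itv /= andbT => /andP[_ ur].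
  by apply/negP; rewrite -leNgt.
have -> : \int[leb]_(u in `[0%R, r]) F u = (expR (rho * s * S))%:E *
    \int[leb]_(u in `[0%R, r])
      (expR ((rho * s - 1) * u) * energy (jump (fl x u)))%:E.
  rewrite -ge0_integralZl_EFin ?expR_ge0 //; last 2 first.
  - by move=> u _; rewrite lee_fin mulr_ge0 ?expR_ge0 ?lyapunov_ge0.
  - by apply/measurable_EFinP/measurable_funTS; exact: measurable_discounted_jump.
  by apply: eq_integral => u /set_mem; exact: before.
have -> : \int[leb]_(u in `]r, +oo[) F u =
    (expR (rho * s * S) * (expR (rho * s * r) * energy (fl x r)))%:E
      * \int[leb]_(u in `]r, +oo[) (expR (- u))%:E.
  rewrite -ge0_integralZl_EFin; last 4 first.
  - by [].
  - by move=> u _; rewrite lee_fin expR_ge0.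
  - by apply/measurable_EFinP/measurable_funTS; exact: measurable_expRN.
  - by rewrite !mulr_ge0 ?expR_ge0 ?lyapunov_ge0.
  by apply: eq_integral => u /set_mem; exact: after.
have assoc (a b c : R) : (a * b)%:E * c%:E = a%:E * (b * c)%:E.
  by rewrite -!EFinM mulrA.
rewrite exponential_tail assoc -muleDr //; last first.
  rewrite ge0_adde_def // inE ?lee_fin ?mulr_ge0 ?expR_ge0 ?lyapunov_ge0 //.
  by apply: integral_ge0 => u _; rewrite lee_fin mulr_ge0 ?expR_ge0 ?lyapunov_ge0.
apply: lee_wpmul2l; first by rewrite lee_fin expR_ge0.
have -> : (expR (rho * s * r) * energy (fl x r) * expR (- r) =
   expR ((rho * s - 1) * r) * energy (fl x r))%R.
  by rewrite mulrAC -expRD; congr (expR _ * _)%R; ring.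
exact: flow_energy_integral.
Qed.

End Step.

(** * The history of an independent sequence *)

Section Past.
Context {disp : measure_display} {Omega : measurableType disp} {R : realType}
  (P : probability Omega R) (X : nat -> Omega -> R).
Hypothesis mX : forall i, measurable_fun setT (X i).
Hypothesis Xind : mutually_independent P X.

Definition past_event (k : nat) (A : nat -> set R) : set Omega :=
  [set omega | forall i, (i < k)%N -> A i (X i omega)].

(** A pi-system that generates the sigma-algebra of [X 0], ..., [X (k - 1)]. *)
Definition past (k : nat) : set (set Omega) :=
  [set C | exists2 A, forall i, measurable (A i) & C = past_event k A].

Lemma measurable_past_event k A : (forall i, measurable (A i)) -> measurable (past_event k A).
Proof.
move=> mA; rewrite (_ : past_event k A = \bigcap_(i in [set i | (i < k)%N]) X i @^-1` A i) //.
apply: bigcap_measurableType => i _.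
by rewrite -[X in measurable X]setTI; exact: mX.
Qed.

Lemma past_measurable k : past k `<=` measurable.
Proof. by move=> _ [A mA ->]; exact: measurable_past_event. Qed.

Lemma past_setT k : past k setT.
Proof. by exists (fun=> setT) => //; apply/seteqP. Qed.

Lemma past_setI k : setI_closed (past k).
Proof.
move=> _ _ [A mA ->] [B mB ->]; exists (fun i => A i `&` B i).
  by move=> i; exact: measurableI.
apply/seteqP; split=> [w [wA wB] i ik|w wAB].
  by split; [exact: wA|exact: wB].
by split=> i /wAB[].
Qed.

Lemma prob_past_event k A : (forall i, measurable (A i)) ->
  (P (past_event k A) = \prod_(i < k) P (X i @^-1` A i))%E.
Proof.
move=> mA; pose J := [fset i | i in iota 0 k]%fset.
have memJ i : (i \in J) = (i < k)%N.
  by apply/imfsetP/idP => [[j /= + ->]|ik]; [|exists i => //=]; rewrite mem_iota add0n.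
have -> : past_event k A = \bigcap_(i in [set` J]) (X i @^-1` A i).
  by apply/seteqP; split=> w wA i /=; [rewrite memJ|rewrite -memJ]; exact: wA.
rewrite Xind // -(big_mkord xpredT (fun i => P (X i @^-1` A i))).
apply: perm_big; apply: uniq_perm; rewrite ?fset_uniq ?iota_uniq //.
by move=> i; rewrite mem_index_iota /= memJ.
Qed.

(** Intersecting with an event on [X k] gives an event on the first [k + 1]
    variables, and both probabilities are products. *)
Lemma past_independent k C B : past k C -> measurable B ->
  (P (C `&` X k @^-1` B) = P C * P (X k @^-1` B))%E.
Proof.
move=> [A mA ->] mB; pose A' i := if i == k then B else A i.
have mA' i : measurable (A' i) by rewrite /A'; case: eqP.
have -> : past_event k A `&` X k @^-1` B = past_event k.+1 A'.
  apply/seteqP; split=> [w [wA wB] i|w wA'].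
    by rewrite ltnS leq_eqVlt /A'; case: eqP => [->//|_ /= /wA].
  split=> [i ik|]; last by have := wA' k (ltnSn k); rewrite /A' eqxx.
  by have := wA' i (ltnW ik); rewrite /A' (ltn_eqF ik).
rewrite !prob_past_event // big_ord_recr /= {2}/A' eqxx; congr (_ * _)%E.
by apply: eq_bigr => i _; rewrite /A' ltn_eqF.
Qed.

Lemma past_measurable_fun k i : (i < k)%N ->
  measurable_fun setT (X i : g_sigma_algebraType (past k) -> R).
Proof.
move=> ik _ B mB; rewrite setTI; apply: sub_sigma_algebra.
exists (fun j => if j == i then B else setT); first by move=> j; case: ifP.
apply/seteqP; split=> [w wB j _|w /(_ i ik)]; last by rewrite eqxx.
by case: eqP => // ->.
Qed.

End Past.

(** * The states at the jump times and their expected energy *)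

Section Chain.
Context {R : realType} {d : nat} (f : 'rV[R]_d -> R) (wstar : 'rV[R]_d)
  (L rho mu : R).
Local Notation V := 'rV[R]_d.
Implicit Types x : V * V.
Hypotheses (L0 : 0 < L) (rho0 : 0 < rho) (mu0 : 0 < mu).
Hypothesis df : forall y, differentiable f y.
Hypothesis fmin : global_minimizer f wstar.
Hypothesis fL : smooth L f.
Hypothesis fsqc : strongly_quasar_convex rho mu f wstar.

Local Notation s := (Num.sqrt (mu / L)).
Local Notation energy := (lyapunov f wstar mu).
Local Notation fl := (flow s rho).
Local Notation jump := (gradient_jump f (1 / L) (1 / Num.sqrt (mu * L))).

Definition elapsed (delta : nat -> R) k := \sum_(i < k) delta i.

(** The state just after the k-th jump, for waiting times [delta]. *)
Fixpoint chain (x0 : V * V) (delta : nat -> R) k : V * V :=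
  if k is k'.+1 then jump (fl (chain x0 delta k') (delta k')) else x0.

Lemma elapsedS delta k : elapsed delta k.+1 = elapsed delta k + delta k.
Proof. by rewrite /elapsed big_ord_recr. Qed.

Section Measurability.
Context {disp : measure_display} {T : measurableType disp} (X : nat -> T -> R).

Lemma measurable_elapsed k : (forall i, (i < k)%N -> measurable_fun setT (X i)) ->
  measurable_fun setT (fun w => elapsed (X ^~ w) k).
Proof.
elim: k => [|k IH] mX.
  by rewrite (_ : (fun w => _) = cst 0) //; apply/funext => w; rewrite /elapsed big_ord0.
under eq_fun do rewrite elapsedS; apply: measurable_funD; last exact: mX.
by apply: IH => i ik; apply: mX; exact: ltnW.
Qed.

Lemma measurable_chain x0 k : (forall i, (i < k)%N -> measurable_fun setT (X i)) ->
  state_measurable (fun w => chain x0 (X ^~ w) k).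
Proof.
elim: k => [|k IH] mX; first by split => i /=; exact: measurable_cst.
apply: measurable_jump => //; apply: measurable_flow => //; last exact: mX.
by apply: IH => i ik; apply: mX; exact: ltnW.
Qed.

End Measurability.

Context {disp : measure_display} {Omega : measurableType disp}
  (P : probability Omega R) (X : nat -> Omega -> R).
Hypothesis mX : forall i, measurable_fun setT (X i).
Hypothesis Xind : mutually_independent P X.
Hypothesis Xexp : forall k (A : set R), measurable A ->
    pushforward P (X k) A = exponential_prob 1 A.
Local Open Scope ereal_scope.

Local Notation at_jump t x0 k := (fun w =>
  (energy_at_jump f wstar L rho mu t (elapsed (X ^~ w) k) (chain x0 (X ^~ w) k))%:E).
Local Notation between t x0 k := (fun w =>
  (energy_between f wstar L rho mu t (elapsed (X ^~ w) k) (chain x0 (X ^~ w) k) (X k w))%:E).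

Lemma measurable_at_jump t x0 k : measurable_fun setT (at_jump t x0 k).
Proof.
apply/measurable_EFinP; apply: measurable_energy_at_jump => //.
  exact: measurable_elapsed.
exact: measurable_chain.
Qed.

Lemma measurable_between t x0 k : measurable_fun setT (between t x0 k).
Proof.
apply/measurable_EFinP; apply: measurable_energy_between => //.
  exact: measurable_elapsed.
exact: measurable_chain.
Qed.

(** The time and the state of the k-th jump are functions of the past, hence
    independent of the next waiting time: integrate that waiting time first,
    where [one_step_energy] applies pointwise. *)
Lemma expected_energy_step t x0 k :
  \int[P]_w between t x0 k w + \int[P]_w at_jump t x0 k.+1 w
  <= \int[P]_w at_jump t x0 k w.
Proof.
rewrite -ge0_integralD //; last 4 first.
- by move=> w _; rewrite lee_fin energy_between_ge0.
- exact: measurable_between.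
- by move=> w _; rewrite lee_fin energy_at_jump_ge0.
- exact: measurable_at_jump.
(* Lebesgue measure lives on [measurableTypeR R], whose measurable sets are
   those of [R] but whose structure is a different one. *)
have mXk : measurable_fun setT (X k : Omega -> measurableTypeR R) by exact: mX.
pose Ymix := isMeasurableFun.Build _ _ _ _ _ mXk.
pose Y : {RV P >-> measurableTypeR R} :=
  HB.pack (X k : Omega -> measurableTypeR R) Ymix.
pose F (p : g_sigma_algebraType (past X k) * measurableTypeR R) : \bar R :=
  let S := elapsed (X ^~ p.1) k in let x := chain x0 (X ^~ p.1) k in
  (energy_between f wstar L rho mu t S x p.2
   + energy_at_jump f wstar L rho mu t (S + p.2) (jump (fl x p.2)))%:E.
have F0 p : 0 <= F p.
  by rewrite lee_fin addr_ge0 ?energy_between_ge0 ?energy_at_jump_ge0.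
have mF : measurable_fun setT F.
  have m2 : measurable_fun setT
    (fun p : g_sigma_algebraType (past X k) * measurableTypeR R => p.2 : R).
    exact: measurable_snd.
  have mX1 i : (i < k)%N -> measurable_fun setT
      (fun p : g_sigma_algebraType (past X k) * measurableTypeR R => X i p.1).
    by move=> ik; apply: measurableT_comp; [exact: past_measurable_fun|exact: measurable_fst].
  have mS := measurable_elapsed mX1.
  have mx := measurable_chain x0 mX1.
  apply/measurable_EFinP; apply: measurable_funD.
    exact: measurable_energy_between.
  apply: measurable_energy_at_jump => //; first exact: measurable_funD.
  by apply: measurable_jump => //; exact: measurable_flow.
rewrite [leLHS](_ : _ = \int[P]_w F (w, Y w)); last first.
  by apply: eq_integral => w _; rewrite /F /= elapsedS EFinD.
rewrite (ge0_integral_independent_pi_system (past_measurable mX (k := k))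
  (past_setT X k) (@past_setI _ _ _ X k) (Y := Y)) //; last first.
  by move=> C B; exact: past_independent.
have mint : measurable_fun setT
    ((fun w => \int[distribution P Y]_u F (w, u)) : g_sigma_algebraType (past X k) -> \bar R).
  exact: measurable_fun_fubini_tonelli_F.
apply: ge0_le_integral => //.
- by move=> w _; exact: integral_ge0.
- exact: (measurableT_comp mint (measurable_id_g_sigma (past_measurable mX (k := k)))).
- exact: measurable_at_jump.
move=> w _.
have law A : measurable A -> distribution P Y A = exponential_prob 1 A by exact: Xexp.
have mFw : measurable_fun setT (fun u : measurableTypeR R => F (w, u)).
  by apply: (measurableT_comp mF); exact: pair1_measurable.
rewrite (integral_exponential_law law mFw (fun u => F0 (w, u))).
exact: (one_step_energy L0 rho0 mu0 df fmin fL fsqc t (elapsed (X ^~ w) k)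
  (chain x0 (X ^~ w) k)).
Qed.

(** The steps telescope from the initial state, whose jump time is 0. *)
Lemma expected_energy_le t x0 n : (0 <= t)%R ->
  \sum_(k < n) \int[P]_w between t x0 k w + \int[P]_w at_jump t x0 n w
  <= (energy x0)%:E.
Proof.
move=> t0; elim: n => [|n IH].
  rewrite big_ord0 add0e.
  under eq_integral do rewrite /elapsed big_ord0 /energy_at_jump t0 mulr0 expR0 mul1r /=.
  by rewrite integral_cst //= probability_setT mule1.
apply: le_trans IH; rewrite big_ord_recr /= -addeA leeD2l //.
exact: expected_energy_step.
Qed.

End Chain.

(** * Sample paths follow the flow *)

Section CoordDerivative.
Context {R : realType} {d : nat}.

Lemma is_derive_coord (w : R -> 'rV[R]_d) (t : R) dw i :
  is_derive t 1 w dw -> is_derive t 1 (fun t => w t 0 i) (dw 0 i).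
Proof.
move=> dwt; have wd : derivable w t 1 by exact: ex_derive.
apply: DeriveDef; first exact: (derivable_mxP w t 1).1.
have := @derive_val _ _ _ _ _ _ _ dwt; rewrite derive_mx // => /matrixP /(_ 0 i).
by rewrite mxE.
Qed.

Lemma cvg_coord (w : R -> 'rV[R]_d) (F : set_system R) (l : 'rV[R]_d) i :
  Filter F -> w t @[t --> F] --> l -> w t 0 i @[t --> F] --> l 0 i.
Proof.
move=> FF wl.
exact: (cvg_comp w (fun M : 'rV[R]_d => M 0 i) wl (@coord_continuous R 1 d 0 i l)).
Qed.

Lemma zero_derivative_constant (g : R -> R) (a b : R) :
  (forall t, a < t < b -> is_derive t 1 g 0) ->
  g t @[t --> a^'+] --> g a ->
  forall t, a <= t < b -> g t = g a.
Proof.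
move=> dg ga t /andP[]; rewrite le_eqVlt => /predU1P[->//|at_] tb.
have inside x : x \in `]a, t[ -> a < x < b.
  by rewrite in_itv /= => /andP[-> /lt_trans]; exact.
have gcont x : a < x < b -> {for x, continuous g}.
  move=> /dg dgx; apply: differentiable_continuous; apply/derivable1_diffP.
  exact: ex_derive.
have gwithin : {within `[a, t], continuous g}.
  apply/continuous_within_itvP => //; split => //.
    by move=> x /inside /gcont.
  by apply: cvg_at_left_filter; apply: gcont; rewrite at_.
have [c _] := MVT at_ (fun x xi => dg x (inside x xi)) gwithin.
by rewrite mul0r => /eqP; rewrite subr_eq0 => /eqP.
Qed.

End CoordDerivative.

Section Path.
Context {R : realType} {d : nat}.
Local Notation V := 'rV[R]_d.
Variables (s rho : R).
Hypothesis rho0 : 0 < rho.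

(** The quantities [rho w + z] and [exp ((1 + rho) s t) (z - w)] are conserved,
    and they determine [w] and [z]. *)
Lemma ode_flow (w z : R -> V) (a b : R) :
  (forall t, a < t < b -> is_derive t 1 w (s *: (z t - w t)) /\
     is_derive t 1 z ((rho * s) *: (w t - z t))) ->
  w t @[t --> a^'+] --> w a -> z t @[t --> a^'+] --> z a ->
  forall t, a <= t < b -> (w t, z t) = flow s rho (w a, z a) (t - a).
Proof.
move=> ode wa za t tab.
have rho1 : 1 + rho != 0 by rewrite gt_eqF // ltr_wpDl.
have sumE i : rho * w t 0 i + z t 0 i = rho * w a 0 i + z a 0 i.
  apply: (zero_derivative_constant (g := fun t => rho * w t 0 i + z t 0 i) _ _ tab).
    move=> u /ode[/(is_derive_coord i) dw /(is_derive_coord i) dz].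
    by apply: is_derive_eq; rewrite !mxE /GRing.scale /=; ring.
  by apply: cvgD; [apply: cvgMl_tmp|]; exact: cvg_coord.
have diffE i : expR ((1 + rho) * s * t) * (z t 0 i - w t 0 i)
    = expR ((1 + rho) * s * a) * (z a 0 i - w a 0 i).
  apply: (zero_derivative_constant
    (g := fun t => expR ((1 + rho) * s * t) * (z t 0 i - w t 0 i)) _ _ tab).
    move=> u /ode[/(is_derive_coord i) dw /(is_derive_coord i) dz].
    have dlin : is_derive u 1 (fun u => (1 + rho) * s * u) ((1 + rho) * s).
      by apply: is_derive_eq; rewrite /GRing.scale /=; ring.
    have dexp : is_derive u 1 (fun u => expR ((1 + rho) * s * u))
        (expR ((1 + rho) * s * u) * ((1 + rho) * s)).
      exact: (is_derive1_comp (f := expR)).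
    by apply: is_derive_eq; rewrite !mxE /GRing.scale /=; ring.
  apply: cvgM; last by apply: cvgB; exact: cvg_coord.
  apply: cvg_at_right_filter; apply: continuous_comp; last exact: continuous_expR.
  by apply: cvgMl_tmp; exact: cvg_id.
have {}diffE i : z t 0 i - w t 0 i
    = expR (- ((1 + rho) * s * (t - a))) * (z a 0 i - w a 0 i).
  apply: (mulfI (lt0r_neq0 (expR_gt0 ((1 + rho) * s * t)))).
  by rewrite diffE mulrA -expRD; congr (expR _ * _); ring.
have wE i : w t 0 i = (rho * w a 0 i + z a 0 i
    - expR (- ((1 + rho) * s * (t - a))) * (z a 0 i - w a 0 i)) / (1 + rho).
  by rewrite -sumE -diffE; field.
congr pair; apply/rowP => i; rewrite !mxE /mixing /=.
  by rewrite wE; field.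
have -> : z t 0 i = w t 0 i + expR (- ((1 + rho) * s * (t - a))) * (z a 0 i - w a 0 i).
  by rewrite -diffE addrC subrK.
by rewrite wE; field.
Qed.

End Path.

Section PathChain.
Context {R : realType} {d : nat} (f : 'rV[R]_d -> R) (L rho mu : R).
Local Notation V := 'rV[R]_d.
Hypothesis rho0 : 0 < rho.
Local Notation s := (Num.sqrt (mu / L)).

Lemma left_limit_flow (w z : R -> V) (x : V * V) (a b : R) : a < b ->
  (forall t, a <= t < b -> (w t, z t) = flow s rho x (t - a)) ->
  w t @[t --> b^'-] --> (flow s rho x (b - a)).1 /\
  z t @[t --> b^'-] --> (flow s rho x (b - a)).2.
Proof.
move=> ab wz; have [c1 c2] := flow_continuous s x rho0.
have shiftc : (t - a) @[t --> b] --> b - a by apply: cvgB; [exact: cvg_id|exact: cvg_cst].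
split.
- apply: (@cvg_trans _ ((flow s rho x (t - a)).1 @[t --> b^'-])).
    apply: near_eq_cvg; near=> t; rewrite -wz //=; apply/andP; split=> //.
    near: t; exact: nbhs_left_ge.
  apply: cvg_at_left_filter.
  exact: (cvg_comp (fun t => t - a) (fun u => (flow s rho x u).1) shiftc (c1 _)).
- apply: (@cvg_trans _ ((flow s rho x (t - a)).2 @[t --> b^'-])).
    apply: near_eq_cvg; near=> t; rewrite -wz //=; apply/andP; split=> //.
    near: t; exact: nbhs_left_ge.
  apply: cvg_at_left_filter.
  exact: (cvg_comp (fun t => t - a) (fun u => (flow s rho x u).2) shiftc (c2 _)).
Unshelve. all: by end_near. Qed.

(** Between jumps the path is the flow, hence the left limit at the next jump is
    the end point of the flow, and the prescribed jump leads to the next state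
    of the chain. *)
Lemma path_is_chain (w0 z0 : V) (T : nat -> R) (w z : R -> V) :
  T 0%N = 0 -> (forall k, T k < T k.+1) ->
  continuized_path f (fun=> s) (fun=> rho * s) (fun=> 1 / L)
    (fun=> 1 / Num.sqrt (mu * L)) w0 z0 T w z ->
  let x k := chain f L rho mu (w0, z0) (fun k => T k.+1 - T k) k in
  forall k t, T k <= t < T k.+1 -> (w t, z t) = flow s rho (x k) (t - T k).
Proof.
move=> T0 TS [[iw iz] ode rc jumps] x.
have on_interval k : (w (T k), z (T k)) = x k ->
    forall t, T k <= t < T k.+1 -> (w t, z t) = flow s rho (x k) (t - T k).
  move=> <- t tk; have [rw rz] := rc k.
  exact: (ode_flow rho0 (fun t => ode k t) rw rz tk).
suff at_jump k : (w (T k), z (T k)) = x k by move=> k; exact: on_interval.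
elim: k => [|k IH]; first by rewrite T0 iw iz.
have [lw lz] := left_limit_flow (TS k) (on_interval k IH).
have [wl [zl [cw cz -> ->]]] := jumps k.
have -> : wl = (flow s rho (x k) (T k.+1 - T k)).1 by exact: (cvg_unique _ cw lw).
have -> : zl = (flow s rho (x k) (T k.+1 - T k)).2 by exact: (cvg_unique _ cz lz).
by [].
Qed.

End PathChain.

(** * The discrete algorithm samples the process at its jumps *)

Section DiscreteChain.
Context {R : realType} {d : nat} (f : 'rV[R]_d -> R) (L rho mu : R).
Hypothesis rho0 : 0 < rho.
Local Notation s := (Num.sqrt (mu / L)).

(** [tau] is [mixing] at the waiting time.  The algorithm updates [z] from the
    point [v] already moved towards [z]; since
    [v - z = (rho + e) / (1 + rho) * (w - z)], the factor [tau'] is the one for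
    which [tau' (v - z) = rho tau (w - z)]. *)
Lemma discrete_iter_chain w0 z0 (delta : nat -> R) k :
  let e k := expR (- ((1 + rho) * s * delta k)) in
  discrete_iter f (fun k => 1 / (1 + rho) * (1 - e k))
    (fun k => rho * (1 - e k) / (rho + e k))
    (fun=> 1 / L) (fun=> 1 / Num.sqrt (mu * L)) w0 z0 k
  = chain f L rho mu (w0, z0) delta k.
Proof.
move=> e; elim: k => [//|k IH]; rewrite [LHS]/= IH /=.
case: (chain f L rho mu (w0, z0) delta k) => w z.
have rho1 : 1 + rho != 0 by rewrite gt_eqF // ltr_wpDl.
have rhoe : rho + e k != 0 by rewrite gt_eqF // addr_gt0 // expR_gt0.
have tauE : 1 / (1 + rho) * (1 - e k) = mixing s rho (delta k).
  by rewrite /mixing -/(e k); field.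
rewrite /gradient_jump /= -tauE; congr (_, _ - _).
by apply/rowP => i; rewrite !mxE; field; rewrite rhoe rho1.
Qed.

End DiscreteChain.

(** * Finitely many jumps in bounded time *)

Section Unbounded.
Context {disp : measure_display} {Omega : measurableType disp} {R : realType}
  (P : probability Omega R) (X : nat -> Omega -> R).
Hypothesis mX : forall i, measurable_fun setT (X i).
Hypothesis Xind : mutually_independent P X.
Hypothesis Xexp : forall k (A : set R), measurable A ->
    pushforward P (X k) A = exponential_prob 1 A.

(** The first [n] waiting times are all at most [t] with probability
    [(1 - exp (- t)) ^ n], which tends to 0. *)
Lemma ae_large_increment (t : R) : 0 < t ->
  {ae P, forall w, exists k, ~ (0 <= X k w <= t)}.
Proof.
move=> t0; pose B := \bigcap_n past_event X n (fun=> `[0, t]%classic).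
have mB : measurable B.
  by apply: bigcapT_measurable => n; exact: measurable_past_event.
have PB n : (P B <= ((1 - expR (- t)) ^+ n)%:E)%E.
  apply: (@le_trans _ _ (P (past_event X n (fun=> `[0, t]%classic)))).
    apply: le_measure; rewrite ?inE //; first exact: measurable_past_event.
    by move=> w; exact.
  rewrite prob_past_event //.
  under eq_bigr => i _.
    rewrite [P _](Xexp i (measurable_itv _)) exponential_prob_itv0c // mulN1r -EFinB; over.
  by rewrite prodEFin prodr_const card_ord.
have PB0 : P B = 0%E.
  apply/eqP; rewrite eq_le measure_ge0 andbT.
  have lim0 : ((1 - expR (- t)) ^+ n)%:E @[n --> \oo] --> 0%E.
    apply: cvg_EFin; first by near=> n.
    apply: cvg_expr; rewrite ger0_norm ?subr_ge0 ?expR_le1 ?oppr_le0 ?ltW //.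
    by rewrite gtrBl expR_gt0.
  rewrite -(cvg_lim _ lim0) //; apply: lime_ge; first by apply/cvg_ex; exists 0%E.
  by near=> n; exact: PB.
exists B; split => // w /= nw n _ i _; apply: contrapT => Xi.
by apply: nw; exists i; rewrite /= in_itv /= in Xi.
Unshelve. all: by end_near. Qed.

End Unbounded.

(** * The two bounds *)

Section Main.
Context {R : realType} {disp : measure_display}
    {Omega : measurableType disp} (P : probability Omega R)
    (T : nat -> {RV P >-> R}) {d : nat} (f : 'rV[R]_d -> R)
    (wstar : 'rV[R]_d) (L rho mu : R).
Hypothesis HT : random_times T.
Hypotheses (L0 : 0 < L) (rho0 : 0 < rho) (mu0 : 0 < mu).
Hypothesis df : forall x, differentiable f x.
Hypothesis fmin : global_minimizer f wstar.
Hypothesis fL : smooth L f.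
Hypothesis fsqc : strongly_quasar_convex rho mu f wstar.
Local Notation s := (Num.sqrt (mu / L)).
Local Notation energy := (lyapunov f wstar mu).
Local Notation X := (increment T).

Lemma measurable_increment k : measurable_fun setT (X k).
Proof. by apply: measurable_funB; exact: measurable_funPT. Qed.

Lemma elapsed_increment w k : T 0%N w = 0 -> elapsed (X ^~ w) k = T k w.
Proof.
move=> T0; elim: k => [|k IH]; first by rewrite /elapsed big_ord0 T0.
by rewrite elapsedS IH /increment /= addrC subrK.
Qed.

(** If no jump time exceeds [t], then no waiting time exceeds [t + 1]. *)
Lemma ae_interval (t : R) : 0 <= t ->
  {ae P, forall w, exists k, T k w <= t < T k.+1 w}.
Proof.
move=> t0.
have t1 : 0 < t + 1 by rewrite ltr_wpDl.
have Xlarge := ae_large_increment measurable_increment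
  (random_times_independent HT) (random_times_exponential HT) t1.
apply: filterS2 Xlarge (random_times_order HT) => w [i Xi] [T0 TS].
have Tge0 k : 0 <= T k w.
  by elim: k => [|k IH]; [rewrite T0|exact: le_trans IH (ltW (TS k))].
have exT : exists n, t < T n w.
  exists i.+1; rewrite ltNge; apply/negP => Tit; apply: Xi.
  rewrite /increment /= subr_ge0 (ltW (TS i)) /= lerBlDr.
  by rewrite (le_trans Tit) // -addrA lerDl addr_ge0.
case: (ex_minnP exT) => -[|k]; first by rewrite T0 ltNge t0.
move=> tk kmin; exists k; rewrite tk andbT leNgt.
by apply/negP => /kmin; rewrite ltnn.
Qed.

Local Open Scope ereal_scope.

(** Monotone convergence in the horizon, which removes the indicator in
    [energy_at_jump]. *)
Lemma expected_energy_at_jump x0 k :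
  \int[P]_w (expR (rho * s * elapsed (X ^~ w) k)
     * energy (chain f L rho mu x0 (X ^~ w) k))%:E <= (energy x0)%:E.
Proof.
pose g (m : nat) w := (energy_at_jump f wstar L rho mu m%:R (elapsed (X ^~ w) k)
  (chain f L rho mu x0 (X ^~ w) k))%:E.
have gE w : (expR (rho * s * elapsed (X ^~ w) k)
     * energy (chain f L rho mu x0 (X ^~ w) k))%:E = limn (g ^~ w).
  apply/esym/cvg_lim => //; apply: cvg_near_cst; near=> m.
  rewrite /g /energy_at_jump ifT //; near: m; exact: nbhs_infty_ger.
under eq_integral do rewrite gE.
have mg m : measurable_fun setT (g m).
  by apply: measurable_at_jump => //; exact: measurable_increment.
have g0 m w : 0 <= g m w by rewrite lee_fin energy_at_jump_ge0.
have gnd w : {homo g ^~ w : m n / (m <= n)%N >-> m <= n}.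
  move=> m n mn; rewrite lee_fin /energy_at_jump.
  case: ifP => [Sm|_]; last exact: energy_at_jump_ge0.
  by rewrite ifT // (le_trans Sm) // ler_nat.
rewrite monotone_convergence //.
apply: lime_le.
  apply: ereal_nondecreasing_is_cvgn => m n mn.
  by apply: ge0_le_integral => // w _; exact: gnd.
near=> m; have /(le_trans _) := expected_energy_le L0 rho0 mu0 df fmin fL fsqc
  measurable_increment (random_times_independent HT) (random_times_exponential HT)
  x0 k (ler0n R m).
apply; rewrite leeDr //; apply: sume_ge0 => i _; apply: integral_ge0 => w _.
by rewrite lee_fin energy_between_ge0.
Unshelve. all: by end_near. Qed.

Lemma discrete_bound x0 k :
  \int[P]_w (expR (rho * s * T k w)
     * (f (chain f L rho mu x0 (X ^~ w) k).1 - f wstar))%:E <= (energy x0)%:E.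
Proof.
apply: le_trans (expected_energy_at_jump x0 k).
have mchain : state_measurable (fun w => chain f L rho mu x0 (X ^~ w) k).
  by apply: measurable_chain => // i _; exact: measurable_increment.
apply: ae_ge0_le_integral => //.
- by move=> w _; rewrite lee_fin mulr_ge0 ?expR_ge0 // subr_ge0 fmin.
- apply/measurable_EFinP; apply: measurable_funM.
    by apply: measurableT_comp => //; exact: measurable_funM.
  by apply: measurable_funB => //; apply: measurable_objective => //; exact: mchain.1.
- by move=> w _; rewrite lee_fin mulr_ge0 ?expR_ge0 ?lyapunov_ge0.
- apply/measurable_EFinP; apply: measurable_funM; last exact: measurable_lyapunov.
  apply: measurableT_comp => //; apply: measurable_funM => //.
  by apply: measurable_elapsed => i _; exact: measurable_increment.
apply: filterS (random_times_order HT) => w [T0 _] _.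
by rewrite elapsed_increment // lee_fin ler_wpM2l ?expR_ge0 ?le_lyapunov.
Qed.

(** Almost surely [t] falls in exactly one waiting time, so the weighted gap at
    time [t] is at most the sum of all [energy_between]. *)
Lemma continuized_bound w0 z0 w z t :
  continuized_process T f (fun=> s) (fun=> (rho * s)%R) (fun=> (1 / L)%R)
    (fun=> (1 / Num.sqrt (mu * L))%R) w0 z0 w z -> (0 <= t)%R ->
  \int[P]_omega (expR (rho * s * t) * (f (w t omega) - f wstar))%:E
    <= (energy (w0, z0))%:E.
Proof.
move=> [mwz paths] t0.
pose g k omega := (energy_between f wstar L rho mu t (elapsed (X ^~ omega) k)
  (chain f L rho mu (w0, z0) (X ^~ omega) k) (X k omega))%:E.
have g0 k omega : 0 <= g k omega by rewrite lee_fin energy_between_ge0.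
have mg k : measurable_fun setT (g k).
  by apply: measurable_between => //; exact: measurable_increment.
apply: (@le_trans _ _ (\int[P]_omega \sum_(k <oo) g k omega)); last first.
  rewrite integral_nneseries //; apply: lime_le.
    by apply: is_cvg_nneseries => k _ _; exact: integral_ge0.
  near=> n; rewrite big_mkord.
  apply: le_trans (expected_energy_le L0 rho0 mu0 df fmin fL fsqc
    measurable_increment (random_times_independent HT) (random_times_exponential HT)
    (w0, z0) n t0).
  by rewrite leeDl //; apply: integral_ge0 => omega _; rewrite lee_fin energy_at_jump_ge0.
apply: ae_ge0_le_integral => //.
- by move=> omega _; rewrite lee_fin mulr_ge0 ?expR_ge0 // subr_ge0 fmin.
- apply/measurable_EFinP; apply: measurable_funM => //; apply: measurable_funB => //.
  by apply: measurable_objective => // i; exact: (mwz t i t0).1.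
- by move=> omega _; exact: nneseries_ge0.
- exact: ge0_emeasurable_sum.
apply: filterS3 paths (random_times_order HT) (ae_interval t0).
move=> omega path [T0 TS] [k tk] _.
have wzt := path_is_chain rho0 T0 TS path tk.
apply: (@le_trans _ _ (g k omega)).
  rewrite /g /energy_between elapsed_increment // /increment /=.
  rewrite (addrC (T k omega)) subrK tk lee_fin ler_wpM2l ?expR_ge0 //.
  by rewrite -wzt -[w t omega]/(w t omega, z t omega).1; exact: le_lyapunov.
apply: (@le_trans _ _ (\sum_(0 <= i < k.+1) g i omega)).
  by rewrite big_nat_recr //= leeDr // sume_ge0.
exact: nneseries_lim_ge.
Unshelve. all: by end_near. Qed.

End Main.

Theorem theorem2 (R : realType) (disp : measure_display)
    (Omega : measurableType disp) (P : probability Omega R)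
    (T : nat -> {RV P >-> R}) (d : nat) (f : 'rV[R]_d -> R)
    (wstar : 'rV[R]_d) (L rho mu : R) :
  random_times T ->
  0 < L -> 0 < rho -> 0 < mu ->
  (forall x, differentiable f x) ->
  global_minimizer f wstar ->
  smooth L f ->
  strongly_quasar_convex rho mu f wstar ->
  (forall (w0 z0 : 'rV[R]_d) (w z : R -> Omega -> 'rV[R]_d),
    continuized_process T f
      (fun=> Num.sqrt (mu / L)) (fun=> rho * Num.sqrt (mu / L))
      (fun=> 1 / L) (fun=> 1 / Num.sqrt (mu * L)) w0 z0 w z ->
    forall t : R, 0 <= t ->
      ('E_P[fun omega => (f (w t omega) - f wstar)%R] <=
       ((f w0 - f wstar + mu / 2 * enorm (z0 - wstar) ^+ 2)
        * expR (- (rho * Num.sqrt (mu / L) * t)))%:E)%E)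
  /\
  (forall w0 z0 : 'rV[R]_d,
    let e k omega :=
      expR (- ((1 + rho) * Num.sqrt (mu / L)
               * (T k.+1 omega - T k omega))) in
    let tau omega k := 1 / (1 + rho) * (1 - e k omega) in
    let tau' omega k := rho * (1 - e k omega) / (rho + e k omega) in
    let w k omega :=
      (discrete_iter f (tau omega) (tau' omega)
         (fun=> 1 / L) (fun=> 1 / Num.sqrt (mu * L)) w0 z0 k).1 in
    forall k : nat,
      ('E_P[fun omega => (expR (rho * Num.sqrt (mu / L) * T k omega)
                          * (f (w k omega) - f wstar))%R] <=
       (f w0 - f wstar + mu / 2 * enorm (z0 - wstar) ^+ 2)%:E)%E).
Proof.
move=> HT L0 rho0 mu0 df fmin fL fsqc; split.
- move=> w0 z0 w z proc t t0; rewrite unlock.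
  set a := rho * Num.sqrt (mu / L) * t.
  have mw := process_measurable proc.
  rewrite (_ : (\int[P]_omega (f (w t omega) - f wstar)%:E =
      (expR (- a))%:E * \int[P]_omega (expR a * (f (w t omega) - f wstar))%:E)%E).
    rewrite mulrC EFinM lee_wpmul2l ?lee_fin ?expR_ge0 //.
    exact: (continuized_bound HT L0 rho0 mu0 df fmin fL fsqc proc t0).
  rewrite -ge0_integralZl_EFin ?expR_ge0 //.
  + apply: eq_integral => omega _; rewrite -EFinM mulrA -expRD addNr expR0.
    by rewrite mul1r.
  + by move=> omega _; rewrite lee_fin mulr_ge0 ?expR_ge0 // subr_ge0 fmin.
  + apply/measurable_EFinP; apply: measurable_funM => //; apply: measurable_funB => //.
    by apply: measurable_objective => // i; exact: (mw t i t0).1.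
- move=> w0 z0 e tau tau' w k; rewrite unlock.
  apply: le_trans (discrete_bound HT L0 rho0 mu0 df fmin fL fsqc (w0, z0) k).
  rewrite le_eqVlt; apply/orP; left; apply/eqP; apply: eq_integral => omega _.
  by rewrite /w (discrete_iter_chain f L mu rho0 w0 z0 (fun k => increment T k omega)).
Qed.
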